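(* Let $\gamma$ be a circular relative equilibrium (RE) in $\mathbb{R}^4$ of the Newtonian $n$-body problem, generated by a central configuration $q$, and let $B_3$ be the associated symmetric matrix. Suppose that one of the following two conditions holds: (i) $\gamma$ is non-planar, or $\gamma$ is planar but generated by a collinear central configuration $q$, and $$n^-\big(B_3|_{\ker (JB_3)^{8n-16}}\big)-n^-(B_3)\equiv 1 \pmod 2;$$ (ii) $\gamma$ is planar and generated by a (planar) non-collinear central configuration $q$, and $$n^-\big(B_3|_{\ker (JB_3)^{8n-20}}\big)-n^-(B_3)\equiv 1 \pmod 2.$$ Then $\gamma$ is spectrally unstable.
   Context: Newtonian setting: $n\ge 3$ bodies with positions $q_i\in\mathbb{R}^4$ and masses $m_i>0$; $M=\mathrm{diag}(m_1I_4,\dots,m_nI_4)$; $U(q)=\sum_{i<j} m_im_j/|q_i-q_j|$; the equation of motion is $M\ddot q=\nabla U(q)$. $D^2U(q)$ is the Euclidean Hessian. A (normalized) central configuration is $q=(q_1,\dots,q_n)\in\mathbb{R}^{4n}$ with $q_i\ne q_j$ for $i\neq j$, $\sum_i m_iq_i=0$, $\langle Mq,q\rangle=1$ and $\nabla U(q)+U(q)Mq=0$. It is planar (resp. collinear) if all $q_i$ lie in a common linear plane (resp. line) of $\mathbb{R}^4$. Put $k=\sqrt{U(q)}$ and $J_2=\begin{pmatrix}0&-1\\1&0\end{pmatrix}$. Let $K_d$ (resp. $K_s$) be the $4n\times4n$ block-diagonal matrix with $n$ diagonal blocks all equal to $\mathrm{diag}(kJ_2,-kJ_2)$ (resp. $\mathrm{diag}(kJ_2,0)$).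 The circular relative equilibrium (RE) generated by $q$ is the solution $\gamma(t)=e^{tK_d}q$. It is planar if all bodies move in a fixed plane; in that case coordinates of $\mathbb{R}^4$ are taken so that this plane is $\mathbb{R}^2\times\{0\}$, so that $q_j\in\mathbb{R}^2\times\{0\}$ for all $j$ and $\gamma(t)=e^{tK_s}q$. Set $*=d$ if $\gamma$ is non-planar and $*=s$ if $\gamma$ is planar. In rotating coordinates the linearized Hamiltonian system along $\gamma$ is $\dot z=L_*z$ on $\mathbb{R}^{8n}$, with $L_*=\begin{pmatrix}K_*&M^{-1}\\ D^2U(q)&K_*\end{pmatrix}$. In every even dimension $J=\begin{pmatrix}0&-I\\ I&0\end{pmatrix}$ is the standard complex structure and $\omega_0(x,y)=\langle Jx,y\rangle$. Subspaces of $\mathbb{R}^{8n}$: $E_1=\{(v,\dots,v,m_1w,\dots,m_nw): v,w\in\mathbb{R}^4\}$. If $\gamma$ is non-planar, $E_2=\mathrm{span}\{(aq,0),(0,aMq): a\in\{1,\mathbf i,\mathbf j,\mathbf k\}\}$, where $\mathbf i=\begin{pmatrix}0&-1&0&0\\1&0&0&0\\0&0&0&1\\0&0&-1&0\end{pmatrix}$, $\mathbf j=\begin{pmatrix}0&0&1&0\\0&0&0&1\\-1&0&0&0\\0&-1&0&0\end{pmatrix}$, $\mathbf k=\begin{pmatrix}0&0&0&-1\\0&0&1&0\\0&-1&0&0\\1&0&0&0\end{pmatrix}$ act on each of the $n$ blocks $\mathbb{R}^4$. If $\gamma$ is planar, $E_2=\mathrm{span}\{(q,0),(K_{lr}q,0),(0,Mq),(0,MK_{lr}q):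 (l,r)\in\{(1,2),(1,3),(1,4),(2,3),(2,4)\}\}$, where $K_{lr}$ acts on each block $\mathbb{R}^4$ by the matrix with entry $-1$ in position $(l,r)$, $+1$ in position $(r,l)$ and $0$ elsewhere. $E_3$ is the $\omega_0$-orthogonal complement of $E_1\oplus E_2$. These are $L_*$-invariant symplectic subspaces with $\mathbb{R}^{8n}=E_1\oplus E_2\oplus E_3$; $\dim E_3=8n-16$ if $\gamma$ is non-planar or $q$ is collinear, and $\dim E_3=8n-20$ if $\gamma$ is planar and $q$ is non-collinear. $B_3:=JL_3$, where $L_3$ is the matrix of $L_*|_{E_3}$ in a symplectic basis of $E_3$; $B_3$ is symmetric, and the choice of symplectic basis is irrelevant for what follows. $n^-(B)$ is the number of negative eigenvalues of a symmetric matrix $B$, and $n^-(B|_V)$ is the index of the quadratic form $\langle B\cdot,\cdot\rangle$ restricted to a subspace $V$. $\gamma$ is spectrally stable if all eigenvalues of $JB_3$ are purely imaginary (zero allowed), and spectrally unstable otherwise. *)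

(* Defs.v *)
From HB Require Import structures.
From mathcomp Require Import all_boot all_order all_algebra.
From mathcomp Require Import all_classical all_reals all_analysis.
From mathcomp.real_closed Require Import polyrcf complex.
Set Implicit Arguments.
Unset Strict Implicit.
Unset Printing Implicit Defensive.
Import Order.TTheory GRing.Theory Num.Theory.
Import numFieldNormedType.Exports.
Local Open Scope ring_scope.

(* Vectors are columns and matrices act on the left; subspaces are
   [{vspace 'cV[R]_d}].  A vector of R^{4n} lives in
   ['cV[R]_(\sum_(i < n) 4)], the block index format of [\mxcol] and [\mxdiag];
   its n blocks in R^4 are extracted by [submxcol]. *)

Section LinearAlgebra.
Variable R : realType.

Definition dot d (x y : 'cV[R]_d) : R := (x^T *m y) 0 0.
Definition enorm d (x : 'cV[R]_d) : R := Num.sqrt (dot x x).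

Definition mx_of_rows d (rows : seq (seq R)) : 'M[R]_d :=
  \matrix_(i, j) (nth [::] rows i)`_j.

Definition expmx d (A : 'M[R]_d) : 'M[R]_d :=
  \matrix_(i, j) limn (fun N : nat => (\sum_(k < N) (k`!%:R)^-1 *: A ^+ k) i j).

Definition Jmx d : 'M[R]_(d + d) := block_mx 0 (- 1%:M) 1%:M 0.

Definition omega0 d (x y : 'cV[R]_(d + d)) : R := dot (Jmx d *m x) y.

Definition symp_orth d (U : {vspace 'cV[R]_(d + d)}) :
    {vspace 'cV[R]_(d + d)} :=
  (\bigcap_(x <- vbasis U)
     lker (linfun (omega0 x : 'cV[R]_(d + d) -> R^o)))%VS.

(* The columns of S are a symplectic basis of E; the last condition says
   omega0 (col i S) (col j S) = omega0 e_i e_j for the standard basis e. *)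
Definition symplectic_basis d m (E : {vspace 'cV[R]_(d + d)})
    (S : 'M[R]_(d + d, m + m)) : Prop :=
  basis_of E [seq col j S | j : 'I_(m + m)] /\ S^T *m Jmx d *m S = Jmx m.

Definition mxker d (A : 'M[R]_d) : {vspace 'cV[R]_d} :=
  lker (linfun (mulmx A : 'cV[R]_d -> 'cV[R]_d)).

(* Number of negative eigenvalues, counted with multiplicity. *)
Definition nneg d (B : 'M[R]_d) : nat :=
  (\sum_(x <- rootsR (char_poly B) | (x < 0)%R) mup x (char_poly B))%N.

Definition negative_definite_on d (B : 'M[R]_d) (W : {vspace 'cV[R]_d}) : Prop :=
  forall x, x \in W -> x != 0 -> dot (B *m x) x < 0.

(* Index of the quadratic form <B x, x> on V: the largest dimension of a
   subspace of V on which it is negative definite. *)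
Definition nneg_on d (B : 'M[R]_d) (V : {vspace 'cV[R]_d}) : nat :=
  (\max_(k < d.+1 | `[< exists W : {vspace 'cV[R]_d},
      [/\ (W <= V)%VS, \dim W = k & negative_definite_on B W] >]) k)%N.

Definition purely_imaginary_spectrum d (A : 'M[R]_d) : Prop :=
  forall z : R[i], eigenvalue (map_mx (real_complex R) A) z ->
    complex.Re z = 0.

Definition spectrally_stable m (B3 : 'M[R]_(m + m)) : Prop :=
  purely_imaginary_spectrum (Jmx m *m B3).

Definition spectrally_unstable m (B3 : 'M[R]_(m + m)) : Prop :=
  ~ spectrally_stable B3.

End LinearAlgebra.

Section NBody.
Variables (R : realType) (n : nat) (mass : 'I_n -> R).

Definition cdim (n : nat) : nat := (\sum_(i < n) 4)%N.
Local Notation config := ('cV[R]_(cdim n)).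
Local Notation phase := ('cV[R]_(cdim n + cdim n)).
Implicit Types q : config.

Definition body q (i : 'I_n) : 'cV[R]_4 := submxcol q i.

Definition blockwise (A : 'M[R]_4) : 'M[R]_(cdim n) := \mxdiag_(i < n) A.

Definition Mmx : 'M[R]_(cdim n) := \mxdiag_(i < n) ((mass i)%:M : 'M[R]_4).

Definition U q : R :=
  \sum_(i < n) \sum_(j < n | (i < j)%N)
    mass i * mass j / enorm (body q i - body q j).

Definition ei (a : 'I_(cdim n)) : config := delta_mx a 0.

Definition gradU q : config := \col_a 'D_(ei a) U q.

Definition hessU q : 'M[R]_(cdim n) :=
  \matrix_(a, b) 'D_(ei a) (fun x : config => 'D_(ei b) U x) q.

Definition central_configuration q : Prop :=
  [/\ forall i j, i != j -> body q i != body q j,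
      \sum_(i < n) mass i *: body q i = 0,
      dot (Mmx *m q) q = 1 &
      gradU q + U q *: (Mmx *m q) = 0].

Definition planar_configuration q : Prop :=
  exists2 W : {vspace 'cV[R]_4}, \dim W = 2%N & forall i, body q i \in W.

Definition collinear_configuration q : Prop :=
  exists2 W : {vspace 'cV[R]_4}, \dim W = 1%N & forall i, body q i \in W.

Definition kU q : R := Num.sqrt (U q).

Definition J2 : 'M[R]_2 := mx_of_rows 2 [:: [:: 0; -1]; [:: 1; 0]].

Definition Kd q : 'M[R]_(cdim n) :=
  blockwise (block_mx (kU q *: J2) 0 0 (- kU q *: J2) : 'M[R]_(2 + 2)).

Definition Ks q : 'M[R]_(cdim n) :=
  blockwise (block_mx (kU q *: J2) 0 0 0 : 'M[R]_(2 + 2)).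

Definition rel_equilibrium q (t : R) : config := expmx (t *: Kd q) *m q.

Definition planar_RE q : Prop :=
  exists2 W : {vspace 'cV[R]_4}, \dim W = 2%N &
    forall t i, body (rel_equilibrium q t) i \in W.

(* When the motion is planar, coordinates of R^4 are chosen so that it takes
   place in R^2 x {0}; there [Kd q] and [Ks q] have the same flow on q. *)
Definition in_R2x0 (x : 'cV[R]_4) : Prop :=
  forall a : 'I_4, (2 <= a)%N -> x a 0 = 0.

Definition Kstar q : 'M[R]_(cdim n) := if `[< planar_RE q >] then Ks q else Kd q.

Definition Lstar q : 'M[R]_(cdim n + cdim n) :=
  block_mx (Kstar q) (invmx Mmx) (hessU q) (Kstar q).

Definition E1 : {vspace phase} :=
  limg (linfun (fun vw : 'cV[R]_4 * 'cV[R]_4 =>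
    col_mx (\mxcol_(i < n) vw.1) (\mxcol_(i < n) (mass i *: vw.2)) : phase)).

Definition quat_i : 'M[R]_4 := mx_of_rows 4
  [:: [:: 0; -1; 0;  0];
      [:: 1;  0; 0;  0];
      [:: 0;  0; 0;  1];
      [:: 0;  0; -1; 0]].
Definition quat_j : 'M[R]_4 := mx_of_rows 4
  [:: [::  0;  0; 1; 0];
      [::  0;  0; 0; 1];
      [:: -1;  0; 0; 0];
      [::  0; -1; 0; 0]].
Definition quat_k : 'M[R]_4 := mx_of_rows 4
  [:: [:: 0;  0; 0; -1];
      [:: 0;  0; 1;  0];
      [:: 0; -1; 0;  0];
      [:: 1;  0; 0;  0]].

(* The indices l and r run over 1, ..., 4. *)
Definition Klr (l r : nat) : 'M[R]_4 :=
  \matrix_(a, b) (((a.+1 == r) && (b.+1 == l))%:R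
                  - ((a.+1 == l) && (b.+1 == r))%:R).

Definition E2_spanned_by q (As : seq 'M[R]_4) : {vspace phase} :=
  (<<[seq col_mx (blockwise A *m q) 0 | A <- As] ++
     [seq col_mx 0 (Mmx *m (blockwise A *m q)) | A <- As]>>)%VS.

(* [blockwise A] commutes with M, so (0, aMq) = (0, M a q). *)
Definition E2_nonplanar q : {vspace phase} :=
  E2_spanned_by q [:: 1%:M; quat_i; quat_j; quat_k].

Definition E2_planar q : {vspace phase} :=
  E2_spanned_by q [:: 1%:M; Klr 1 2; Klr 1 3; Klr 1 4; Klr 2 3; Klr 2 4].

Definition E2 q : {vspace phase} :=
  if `[< planar_RE q >] then E2_planar q else E2_nonplanar q.

Definition E3 q : {vspace phase} := symp_orth (E1 + E2 q)%VS.

(* L3 is the matrix of the restriction of L_* to E_3 in the symplectic basis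
   formed by the columns of S, and B3 = J L3. *)
Definition associated_B3 q m (B3 : 'M[R]_(m + m)) : Prop :=
  exists S : 'M[R]_(cdim n + cdim n, m + m), exists L3 : 'M[R]_(m + m),
    [/\ symplectic_basis (E3 q) S, Lstar q *m S = S *m L3 &
        B3 = Jmx R m *m L3].

End NBody.

(* Sanity checks: [limg] and [lker] see the maps used above only through
   [linfun], which is meaningful for linear maps only. *)
Section Checks.
Variable R : realType.

Lemma omega0_linear d (x : 'cV[R]_(d + d)) :
  linear (omega0 x : 'cV[R]_(d + d) -> R^o).
Proof. by move=> a u v; rewrite /omega0 /dot mulmxDr -scalemxAr !mxE. Qed.

Lemma mem_symp_orth d (U : {vspace 'cV[R]_(d + d)}) y :
  y \in symp_orth U <-> forall x, x \in U -> omega0 x y = 0.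
Proof.
have linE (x z : 'cV[R]_(d + d)) :
    linfun (omega0 x : 'cV[R]_(d + d) -> R^o) z = omega0 x z.
  pose h := GRing.isLinear.Build R 'cV[R]_(d + d) R^o *:%R
    (omega0 x : 'cV[R]_(d + d) -> R^o) (@omega0_linear d x).
  pose f : {linear 'cV[R]_(d + d) -> R^o} := HB.pack (omega0 x : _ -> R^o) h.
  exact: (lfunE f z).
rewrite /symp_orth; split=> [yU x xU|yU].
  rewrite (coord_vbasis xU) /omega0 mulmx_sumr /dot linear_sum /= mulmx_suml.
  rewrite summxE big1 // => i _.
  rewrite -scalemxAr linearZ /= -scalemxAl mxE.
  suff -> : ((Jmx R d *m (vbasis U)`_i)^T *m y) 0 0 = 0 by rewrite mulr0.
  have /subvP/(_ _ yU) : (\bigcap_(x <- vbasis U)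
      lker (linfun (omega0 x : 'cV[R]_(d + d) -> R^o)) <=
      lker (linfun (omega0 (vbasis U)`_i : 'cV[R]_(d + d) -> R^o)))%VS.
    rewrite (big_nth 0) big_mkord size_tuple.
    exact: (bigcapv_inf (P := predT) i).
  by rewrite memv_ker linE => /eqP.
rewrite big_seq; elim/big_ind : _ => [|V W yV yW|x xU].
- exact: memvf.
- by rewrite memv_cap yV yW.
- by rewrite memv_ker linE yU // vbasis_mem.
Qed.

Lemma mem_mxker d (A : 'M[R]_d) x : (x \in mxker A) = (A *m x == 0).
Proof. by rewrite memv_ker lfunE. Qed.

Lemma mem_E1 n (mass : 'I_n -> R) z :
  z \in E1 mass <-> exists v w : 'cV[R]_4,
    z = col_mx (\mxcol_(i < n) v) (\mxcol_(i < n) (mass i *: w)).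
Proof.
rewrite /E1; set f := (fun vw => _).
have f_lin : linear f.
  move=> a u v; rewrite /f scale_col_mx add_col_mx.
  have mulE (c : 'I_n -> R) (w : 'cV[R]_4) :
      \mxcol_(i < n) (c i *: w) = (\mxcol_(i < n) (c i)%:M) *m w.
    by rewrite mxcol_mul; apply: eq_mxcol => i; rewrite mul_scalar_mx.
  have mul1E (w : 'cV[R]_4) :
      \mxcol_(i < n) w = (\mxcol_(i < n) 1%:M) *m w.
    by rewrite mxcol_mul; apply: eq_mxcol => i; rewrite mul1mx.
  by rewrite !mulE !mul1E /= !mulmxDr -!scalemxAr.
have linE x : linfun f x = f x.
  pose h := GRing.isLinear.Build R _ _ *:%R f f_lin.
  pose g : {linear _ -> _} := HB.pack f h.
  exact: (lfunE g x).
split=> [/memv_imgP[x _ ->]|[v [w ->]]].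
  by exists x.1, x.2; rewrite linE.
have -> : col_mx (\mxcol_(i < n) v) (\mxcol_(i < n) (mass i *: w)) = f (v, w) by [].
by rewrite -linE memv_img ?memvf.
Qed.
End Checks.

(* Main.v *)
(* Write B for B3 and A = J B; B is symmetric because the Hessian of U is.
   Suppose that the spectrum of A is imaginary.  With N = 8n-16 (resp. 8n-20),
   which is at least dim E3, the whole space is the direct sum of ker A^N and
   im A^N (Fitting), and the two summands are B-orthogonal and J-orthogonal.  So
   n^-(B) - n^-(B|ker A^N) is the index of the nondegenerate form B on im A^N.
   There the Gram matrix of B is minus the Gram matrix of J, which is skew, times
   the matrix of A.  Neither factor has a real eigenvalue, so both determinants
   are positive and the index is even, contradicting the hypothesis. *)
Require Import Defs.
From mathcomp Require Import all_boot all_order all_algebra.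
From mathcomp Require Import all_classical all_reals all_analysis.
From mathcomp.real_closed Require Import polyrcf complex.
From mathcomp Require Import ring lra zify.
Set Implicit Arguments.
Unset Strict Implicit.
Unset Printing Implicit Defensive.
Import Order.TTheory GRing.Theory Num.Theory.
Import numFieldNormedType.Exports.
Local Open Scope ring_scope.

(** * Real symmetric matrices *)

(** The two indices are of different nature: [nneg] counts negative roots of a characteristic
    polynomial, [nneg_on] maximises the dimension of negative definite subspaces. Both are reduced
    to the number of negative entries of a diagonal Gram matrix, by the real spectral theorem and
    Sylvester's law of inertia. On im A^N a real eigenvalue of A would be 0, the spectrum being
    imaginary, and 0 is excluded because A is injective there. The Gram matrix of J has no real
    eigenvalue because it is skew and nondegenerate; nondegeneracy is inherited from J through the
    J-orthogonality of the two summands. The bound on dim E3 comes from 16 (resp. 20) independent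
    vectors of E1 + E2: a position copy and a momentum copy of the 4 translations and of 4 (resp. 6)
    matrices applied to q. *)

Section SpectralTheorem.
Variable R : rcfType.

(** Over the complex numbers the matrix is Hermitian, hence unitarily diagonalisable with real
    spectrum; a real eigenvalue of the complexification is an eigenvalue over [R]. *)
Lemma symmetric_eigenvalue d (B : 'M[R]_d.+1) :
  B^T = B -> exists a : R, eigenvalue B a.
Proof.
move=> Bsym; set C := map_mx (real_complex R) B.
have Cherm : C \is hermsymmx.
  apply: realsym_hermsym; last by apply/mxOverP => i j; rewrite mxE complex_real.
  apply/is_hermitianmxP; rewrite expr0 scale1r map_mx_id //.
  by rewrite /C -[in LHS]Bsym; apply/matrixP => i j; rewrite !mxE.
have /hermitian_normalmx /orthomx_spectralP C_eq := Cherm.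
have /mxOverP/(_ ord0 ord0) := hermitian_spectral_diag_real Cherm.
set P := spectralmx C in C_eq; set D := spectral_diag C in C_eq *.
have Punit : P \in unitmx := spectral_unit C.
move=> /complex_realP[a Da]; exists a.
rewrite -(eigenvalue_map (real_complex R)); apply/eigenvalueP; exists (row 0 P).
  rewrite -/C -row_mul {1}C_eq !mulmxA mulmxV // mul1mx row_mul.
  by rewrite row_diag_mx Da -scalemxAl -rowE.
apply: contraTneq Punit => P0; rewrite unitmxE (expand_det_row P ord0) big1 ?unitr0 // => j _.
by move/rowP/(_ j): P0; rewrite !mxE => ->; rewrite mul0r.
Qed.

Lemma row_sqnorm_ge0 d (w : 'rV[R]_d) : 0 <= (w *m w^T) 0 0.
Proof. by rewrite mxE sumr_ge0 // => i _; rewrite mxE -expr2 sqr_ge0. Qed.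

Lemma row_sqnorm_eq0 d (w : 'rV[R]_d) : ((w *m w^T) 0 0 == 0) = (w == 0).
Proof.
apply/eqP/eqP=> [w0|->]; last by rewrite mul0mx mxE.
apply/rowP => i; rewrite mxE; apply/eqP; rewrite -sqrf_eq0.
have /psumr_eq0P w2 : \sum_j w 0 j ^+ 2 = 0.
  by rewrite -[RHS]w0 mxE; apply: eq_bigr => j _; rewrite [w^T _ _]mxE expr2.
by rewrite w2 // => j _; rewrite sqr_ge0.
Qed.

(** [Q] is the reflection along [w = u - e], which exchanges the unit vectors [u] and [e]. For
    [u = e] it degenerates and the identity serves. *)
Lemma householder d (u : 'rV[R]_d.+1) : u *m u^T = 1%:M ->
  exists2 Q : 'M[R]_d.+1, Q^T = Q /\ Q *m Q = 1%:M & row 0 Q = u.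
Proof.
move=> u1; pose e : 'rV[R]_d.+1 := delta_mx 0 0.
have [ue|une] := eqVneq u e.
  by exists 1%:M; rewrite ?trmx1 ?mulmx1 ?row1.
pose w := u - e; pose s := (w *m w^T) 0 0.
have wn0 : s != 0 by rewrite row_sqnorm_eq0 subr_eq0.
have ww : w *m w^T = s%:M by rewrite [LHS]mx11_scalar.
have ee : e *m e^T = 1%:M.
  by rewrite trmx_delta mul_delta_mx; apply/rowP=> i; rewrite !mxE !ord1.
have ue : u *m e^T = e *m u^T.
  by rewrite -[LHS]trmxK trmx_mul trmxK [LHS]mx11_scalar [RHS]mx11_scalar mxE.
(* Since [u] and [e] have the same norm, |w|^2 = 2 - 2<e,u> = -2<e,w>. *)
have ew : e *m w^T = (- (s / 2))%:M.
  have : s%:M = - (2 *: (e *m w^T)).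
    rewrite -ww /w linearB /= !mulmxBl !mulmxBr u1 ee ue.
    by apply/matrixP => i j; rewrite !mxE; ring.
  rewrite [e *m w^T]mx11_scalar => /matrixP/(_ 0 0); rewrite !mxE /= !mulr1n => ->.
  by congr (_%:M); field.
exists (1%:M - (2 / s) *: (w^T *m w)); last first.
  rewrite rowE mulmxBr mulmx1 -scalemxAr mulmxA ew mul_scalar_mx scalerA.
  have -> : 2 / s * - (s / 2) = - 1 by field.
  by rewrite scaleN1r opprK -/e addrC subrK.
split; first by rewrite linearB /= linearZ /= trmx1 trmx_mul trmxK.
rewrite mulmxBl mul1mx (mulmxBr _ 1%:M) mulmx1 -scalemxAl -scalemxAr -mulmxA (mulmxA w) ww.
rewrite mul_scalar_mx -scalemxAr !scalerA.
have -> : 2 / s * (2 / s * s) = 2 / s + 2 / s by field.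
by rewrite scalerDl opprB addrK subrK.
Qed.

(** The deflation step, with the index written as a sum so that block operations typecheck; it is
    used at [p = 1], where [1 + d] is convertible to [d.+1]. *)
Lemma block_orthodiag d p (a : 'rV[R]_p) (C P : 'M[R]_d) (D : 'rV[R]_d) :
  P^T *m P = 1%:M -> P^T *m C *m P = diag_mx D ->
  let P2 : 'M[R]_(p + d) := block_mx 1%:M 0 0 P in
  P2^T *m P2 = 1%:M /\
  P2^T *m block_mx (diag_mx a) 0 0 C *m P2 = diag_mx (row_mx a D).
Proof.
move=> P1 PD; rewrite /= tr_block_mx !mulmx_block !trmx0 trmx1.
rewrite !mulmx0 !mul0mx !addr0 !add0r !mul1mx !mulmx1 P1 PD.
split; first by rewrite -scalar_mx_block.
by rewrite mul0mx diag_mx_row.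
Qed.

(** Deflation: the reflection [Q] carries the first basis vector to a unit eigenvector, so the first
    row of [Q B Q], and by symmetry its first column, vanishes off the diagonal. *)
Theorem symmetric_orthodiag d (B : 'M[R]_d) : B^T = B ->
  exists P : 'M[R]_d, exists2 D : 'rV[R]_d,
    P^T *m P = 1%:M & P^T *m B *m P = diag_mx D.
Proof.
elim: d B => [|d IH] B Bsym.
  by exists 1%:M, 0; apply/matrixP => -[].
have [a /eigenvalueP[v va vn0]] := symmetric_eigenvalue Bsym.
pose c := (Num.sqrt ((v *m v^T) 0 0))^-1; pose u := c *: v.
have u1 : u *m u^T = 1%:M.
  rewrite [LHS]mx11_scalar /u linearZ /= -scalemxAl -scalemxAr scalerA mxE.
  rewrite /c -expr2 exprVn sqr_sqrtr ?row_sqnorm_ge0 // mulVf //.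
  by rewrite row_sqnorm_eq0.
have ua : u *m B = a *: u by rewrite -scalemxAl va !scalerA mulrC.
have [Q [Qs QQ] Qu] := householder u1.
pose C : 'M[R]_(1 + d) := Q *m B *m Q.
have C_sym : C^T = C by rewrite /C !trmx_mul Qs Bsym mulmxA.
have C0 : row 0 C = a *: delta_mx 0 0.
  by rewrite /C !row_mul Qu ua -scalemxAl -Qu -row_mul QQ row1.
have Cb : C = block_mx (diag_mx (const_mx a)) 0 0 (drsubmx C).
  have Cj j : C 0 j = a * (j == 0)%:R.
    by have /rowP/(_ j) := C0; rewrite !mxE eqxx /= => ->.
  rewrite -[LHS]submxK; congr block_mx; apply/matrixP => i j.
  - by rewrite (ord1 i) (ord1 j) mxE mxE !lshift0 Cj !mxE eqxx mulr1.
  - by rewrite (ord1 i) mxE mxE lshift0 Cj mxE mulr0.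
  - by rewrite (ord1 j) mxE mxE lshift0 -C_sym mxE Cj mxE mulr0.
have [|P [D P1 PD]] := IH (drsubmx C); first by rewrite trmx_drsub C_sym.
have [P2P2 P2D] := block_orthodiag (const_mx a : 'rV_1) P1 PD.
exists (Q *m (block_mx 1%:M 0 0 P : 'M[R]_(1 + d))),
  (row_mx (const_mx a : 'rV_1) D : 'rV_(1 + d)).
  rewrite trmx_mul Qs mulmxA -(mulmxA _ Q Q) QQ mulmx1; exact: P2P2.
by rewrite -P2D -Cb trmx_mul Qs /C !mulmxA.
Qed.

End SpectralTheorem.

(** * Index of a quadratic form *)

Section Index.
Variable R : realType.

Lemma dim_cV d : \dim {:'cV[R]_d} = d.
Proof. by rewrite dimvf dim_matrix; apply: muln1. Qed.

(** Sylvester's argument: a negative definite subspace meets [Wp] only in 0, so its dimension is at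
    most dim V - dim Wp. *)
Lemma nneg_onE d (B : 'M[R]_d) (V Wn Wp : {vspace 'cV[R]_d}) :
    (Wn <= V)%VS -> (Wp <= V)%VS -> negative_definite_on B Wn ->
    (forall x, x \in Wp -> 0 <= dot (B *m x) x) ->
    (\dim V <= \dim Wn + \dim Wp)%N ->
  nneg_on B V = \dim Wn.
Proof.
move=> WnV WpV negWn posWp dimV; apply/eqP; rewrite eqn_leq; apply/andP; split.
  apply/bigmax_leqP => k /asboolP[W [WV <- negW]].
  rewrite -(leq_add2r (\dim Wp)); apply: leq_trans dimV.
  rewrite -dimv_disjoint_sum ?dimvS ?subv_add ?WV //.
  apply/eqP; rewrite -subv0; apply/subvP => x; rewrite memv_cap memv0.
  case/andP=> xW xWp; apply: contraT => /(negW _ xW).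
  by rewrite ltNge posWp.
have lt_dim : (\dim Wn < d.+1)%N.
  by rewrite ltnS; apply: leq_trans (dimvS (subvf Wn)) _; rewrite dim_cV.
rewrite /nneg_on.
apply: (leq_bigmax_cond (Ordinal lt_dim)).
by apply/asboolP; exists Wn.
Qed.

Definition mximg d p (T : 'M[R]_(d, p)) : {vspace 'cV[R]_d} :=
  limg (linfun (mulmx T : 'cV[R]_p -> 'cV[R]_d)).

Lemma mximgP d p (T : 'M[R]_(d, p)) x :
  reflect (exists y, x = T *m y) (x \in mximg T).
Proof.
apply: (iffP memv_imgP) => [[y _ ->]|[y ->]]; exists y; rewrite ?lfunE //.
exact: memvf.
Qed.

Lemma dim_mximg d p (T : 'M[R]_(d, p)) :
  (forall y : 'cV_p, T *m y = 0 -> y = 0) -> \dim (mximg T) = p.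
Proof.
move=> Tinj; rewrite limg_dim_eq ?dim_cV //.
apply/eqP; rewrite -subv0; apply/subvP => x; rewrite memv_cap memv_ker lfunE /=.
by case/andP=> _ /eqP/Tinj->; rewrite mem0v.
Qed.

Lemma dot_congr d p (B : 'M[R]_d) (T : 'M[R]_(d, p)) y :
  dot (B *m (T *m y)) (T *m y) = dot (T^T *m B *m T *m y) y.
Proof. by rewrite /dot !trmx_mul trmxK !mulmxA. Qed.

Lemma dot_diag p (D : 'rV[R]_p) (y : 'cV_p) :
  dot (diag_mx D *m y) y = \sum_j D 0 j * y j 0 ^+ 2.
Proof.
rewrite /dot mxE; apply: eq_bigr => j _.
by rewrite mxE mul_diag_mx mxE expr2 mulrA.
Qed.

(** The inclusion of the coordinate subspace indexed by [S]; its transpose extracts the rows in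
    [S]. *)
Definition coord_mx p (S : pred 'I_p) : 'M[R]_(p, #|S|) :=
  \matrix_(i, j) (i == enum_val j)%:R.

Lemma mul_tr_coord_mx p (S : pred 'I_p) q (A : 'M[R]_(p, q)) :
  (coord_mx S)^T *m A = \matrix_(i, j) A (enum_val i) j.
Proof.
apply/matrixP => i j; rewrite !mxE (bigD1 (enum_val i)) //= !mxE eqxx mul1r.
rewrite big1 ?addr0 // => k kj; by rewrite !mxE (negPf kj) mul0r.
Qed.

Lemma coord_mx_diag p (S : pred 'I_p) (D : 'rV[R]_p) :
  (coord_mx S)^T *m diag_mx D *m coord_mx S = diag_mx (\row_j D 0 (enum_val j)).
Proof.
rewrite -mulmxA mul_tr_coord_mx mul_diag_mx; apply/matrixP => i j; rewrite !mxE.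
by rewrite (inj_eq enum_val_inj) mulr_natr.
Qed.

Lemma coord_mx_inj p (S : pred 'I_p) (y : 'cV[R]_#|S|) : coord_mx S *m y = 0 -> y = 0.
Proof.
move=> y0; have: (coord_mx S)^T *m (coord_mx S *m y) = 0 by rewrite y0 mulmx0.
rewrite mulmxA mul_tr_coord_mx => <-; rewrite -[LHS]mul1mx; congr mulmx.
by apply/matrixP => i j; rewrite !mxE (inj_eq enum_val_inj).
Qed.

(** The columns of [T] with negative and with nonnegative diagonal entry span the two subspaces that
    [nneg_onE] asks for. *)
Lemma nneg_on_diag d p (B : 'M[R]_d) (T : 'M[R]_(d, p)) (D : 'rV[R]_p) :
  (forall y : 'cV_p, T *m y = 0 -> y = 0) -> T^T *m B *m T = diag_mx D ->
  nneg_on B (mximg T) = #|[pred i | D 0 i < 0]|.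
Proof.
move=> Tinj TD.
have TEinj S (y : 'cV_#|S|) : T *m coord_mx S *m y = 0 -> y = 0.
  by rewrite -mulmxA => h; apply: coord_mx_inj; apply: Tinj.
have form S (y : 'cV_#|S|) : dot (B *m (T *m coord_mx S *m y)) (T *m coord_mx S *m y) =
    \sum_(j < #|S|) D 0 (enum_val j) * y j 0 ^+ 2.
  rewrite -mulmxA dot_congr TD dot_congr coord_mx_diag dot_diag.
  by apply: eq_bigr => j _; rewrite mxE.
have imgS S : (mximg (T *m coord_mx S) <= mximg T)%VS.
  by apply/subvP => x /mximgP[y ->]; apply/mximgP; exists (coord_mx S *m y); rewrite mulmxA.
set N := [pred i | D 0 i < 0].
rewrite (@nneg_onE _ _ _ (mximg (T *m coord_mx N))
                         (mximg (T *m coord_mx [predC N]))) //.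
- by rewrite dim_mximg //; apply: TEinj.
- move=> x /mximgP[y ->] yn0; rewrite form.
  have [j yj] : exists j, y j 0 != 0.
    apply/existsP; apply: contraT; rewrite negb_exists => /forallP y0.
    move: yn0; rewrite (_ : y = 0) ?mulmx0 ?eqxx //.
    by apply/colP => j; rewrite mxE; apply/eqP; rewrite -[_ == _]negbK.
  have Dneg (k : 'I_#|N|) : D 0 (enum_val k) < 0 by have : N (enum_val k) := enum_valP k.
  rewrite (bigD1 j) //= ltr_wnDr //.
    by apply: sumr_le0 => k _; rewrite nmulr_rle0 ?sqr_ge0.
  by rewrite nmulr_rlt0 // exprn_even_gt0.
- move=> x /mximgP[y ->]; rewrite form; apply: sumr_ge0 => k _.
  have : [predC N] (enum_val k) := enum_valP k; rewrite /= -leNgt => Dk.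
  by rewrite mulr_ge0 ?sqr_ge0.
- by rewrite !dim_mximg; [rewrite cardC card_ord|exact: TEinj|exact: TEinj|].
Qed.

(** As [P] is orthogonal, the congruence is a similarity and preserves the characteristic
    polynomial, whose roots with multiplicity are therefore the entries of [D]. *)
Lemma nneg_diag d (B P : 'M[R]_d) (D : 'rV[R]_d) :
  P^T *m P = 1%:M -> P^T *m B *m P = diag_mx D ->
  nneg B = #|[pred i | D 0 i < 0]|.
Proof.
move=> P1 PD.
have cB : char_poly B = \prod_(y <- [seq D 0 i | i <- enum 'I_d]) ('X - y%:P).
  have -> : char_poly B = char_poly (diag_mx D).
    have [Punit PV] : P \in unitmx /\ invmx P = P^T.
      have [_ Pu] := mulmx1_unit P1; split=> //.
      by rewrite -[LHS]mul1mx -P1 -mulmxA mulmxV ?mulmx1.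
    rewrite -PD -PV /char_poly /char_poly_mx !map_mxM map_invmx.
    set Q := map_mx _ P; have Qu : Q \in unitmx by rewrite map_unitmx.
    have -> : 'X%:M - invmx Q *m map_mx polyC B *m Q =
        invmx Q *m ('X%:M - map_mx polyC B) *m Q.
      by rewrite mulmxBr mulmxBl scalar_mxC mulmxKV.
    by rewrite !det_mulmx det_inv mulrC mulrA mulrV ?mul1r // -unitmxE.
  rewrite char_poly_trig ?diag_mx_is_trig // big_map big_enum /=.
  by apply: eq_bigr => i _; rewrite mxE eqxx.
rewrite /nneg cB; set s := map _ _; set p := \prod_(y <- s) _.
have pn0 : p != 0 by rewrite monic_neq0 // monic_prod_XsubC.
have sR y : y \in s -> y \in rootsR p.
  by rewrite -(roots_on_rootsR pn0) inE /= root_prod_XsubC.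
(* The multiplicity of a root is its number of occurrences in [s]; after exchanging the sums, each
   entry of [s] is counted at the one root equal to it. *)
under eq_bigr do rewrite mu_prod_XsubC -sum1_count big_mkcond.
rewrite exchange_big /=.
transitivity (\sum_(y <- s) (y < 0)%R : nat)%N.
  rewrite !big_seq; apply: eq_bigr => y /sR ys.
  rewrite big_mkcond (bigD1_seq y) ?uniq_roots //=.
  rewrite eqxx big1_seq ?addn0; last by move=> x /andP[/negPf xy _]; rewrite eq_sym xy if_same.
  by case: ifP.
rewrite big_map big_enum /= -sum1_card [RHS]big_mkcond /=.
by apply: eq_bigr => i _; rewrite inE; case: ifP.
Qed.

End Index.

(** * Parity of the index *)

Section RealEigenvalues.
Variable R : rcfType.

(** [eigenvalue] speaks of row vectors; transposing preserves the characteristic polynomial. *)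
Lemma eigenvalue_colP d (M : 'M[R]_d) a :
  reflect (exists2 y : 'cV_d, M *m y = a *: y & y != 0) (eigenvalue M a).
Proof.
have -> : eigenvalue M a = eigenvalue M^T a.
  rewrite !eigenvalue_root_char; congr (root _ _); rewrite /char_poly -det_tr.
  congr determinant; rewrite /char_poly_mx linearB /= tr_scalar_mx.
  by rewrite map_trmx.
apply: (iffP eigenvalueP) => [[v va vn0]|[y ya yn0]].
  exists v^T; last by rewrite trmx_eq0.
  by rewrite -[LHS]trmxK trmx_mul trmxK va linearZ.
by exists y^T; rewrite ?trmx_eq0 // -trmx_mul ya linearZ.
Qed.

(** The characteristic polynomial of [- M] is monic without root on [0, +oo), hence positive at 0,
    where its value is det M. *)
Lemma det_gt0_of_no_eigenvalue d (M : 'M[R]_d) :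
  (forall a, ~~ eigenvalue M a) -> 0 < \det M.
Proof.
move=> noroot; have nomroot x : x \in `[0, +oo[ -> ~~ root (char_poly (- M)) x.
  move=> _; rewrite -eigenvalue_root_char.
  apply: contraNN (noroot (- x)) => /eigenvalueP[v va vn0].
  by apply/eigenvalueP; exists v; rewrite // scaleNr -va mulmxN opprK.
have /(_ 0) := sgp_pinftyP nomroot; rewrite in_itv /= lexx => /(_ isT).
rewrite /sgp_pinfty (monicP (char_poly_monic _)) sgr1 horner_coef0 char_poly_det.
by rewrite -detZ scaleN1r opprK => /eqP; rewrite sgr_cp0.
Qed.

(** An eigenvector [v] for [a] gives a |v|^2 = v M v^T = 0 by skewness, so [a = 0], against
    invertibility. *)
Lemma skew_det_gt0 d (M : 'M[R]_d) : M^T = - M -> \det M != 0 -> 0 < \det M.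
Proof.
move=> Mskew Mn0; apply: det_gt0_of_no_eigenvalue => a.
apply/negP => /eigenvalueP[v va vn0].
have : (v *m M *m v^T) 0 0 = 0.
  have h : (v *m M *m v^T)^T = - (v *m M *m v^T).
    by rewrite !trmx_mul trmxK Mskew mulNmx mulmxN mulmxA.
  by move/matrixP/(_ 0 0): h; rewrite [LHS]mxE [RHS]mxE => h; lra.
rewrite va -scalemxAl mxE => /eqP; rewrite mulf_eq0 row_sqnorm_eq0 (negPf vn0) orbF.
move=> /eqP a0; move: va; rewrite a0 scale0r => va.
have Munit : M \in unitmx by rewrite unitmxE unitfE.
by move: vn0; rewrite -[v](mulmxK Munit) va mul0mx eqxx.
Qed.

Lemma even_neg_of_prod_gt0 p (D : 'rV[R]_p) :
  0 < \prod_j D 0 j -> ~~ odd #|[pred j | D 0 j < 0]|.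
Proof.
move=> Dpos.
have : Num.sg (\prod_j D 0 j) = (-1) ^+ #|[pred j | D 0 j < 0]|.
  have Dn0 j : D 0 j != 0.
    by apply: contraTneq Dpos => Dj; rewrite (bigD1 j) //= Dj mul0r ltxx.
  rewrite -sum1_card (big_morph _ (@sgrM R) (@sgr1 R)).
  rewrite (big_morph _ (exprD (-1 : R)) (expr0 _)) [RHS]big_mkcond /=.
  apply: eq_bigr => j _; rewrite inE; case: ifP => [/ltr0_sg//|/negbT].
  by rewrite -leNgt le_eqVlt eq_sym (negPf (Dn0 j)) => /gtr0_sg.
rewrite gtr0_sg // -signr_odd; case: odd => //= /eqP.
by rewrite expr1 -subr_eq0 opprK; lra.
Qed.

End RealEigenvalues.

(** * Fitting decomposition and its orthogonality *)

Section Fitting.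
Variables (R : realType) (d : nat) (A : 'M[R]_d).

Lemma mulmx_exprD i j (x : 'cV[R]_d) :
  A ^+ (i + j) *m x = A ^+ i *m (A ^+ j *m x).
Proof. by rewrite exprD mulmxA. Qed.

(** Otherwise the kernels of A^i would grow strictly up to i = N+1, and the last would have
    dimension greater than [d]. *)
Lemma mxker_exprS N : (d <= N)%N -> forall x : 'cV[R]_d,
  A ^+ N.+1 *m x = 0 -> A ^+ N *m x = 0.
Proof.
move=> dN x xN1; apply/eqP; apply: contraT => xN.
have grow i : (i <= N.+1)%N -> (i <= \dim (mxker (A ^+ i)))%N.
  elim: i => // i IH iN; apply: (leq_ltn_trans (IH (ltnW iN))).
  rewrite ltnNge; apply/negP => le_dim.
  have sub : (mxker (A ^+ i) <= mxker (A ^+ i.+1))%VS.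
    apply/subvP => y; rewrite !mem_mxker => /eqP y0.
    by rewrite -[i.+1]add1n mulmx_exprD y0 mulmx0.
  have /eqP eq_ker : mxker (A ^+ i) == mxker (A ^+ i.+1) by rewrite eqEdim sub.
  (* This vector is killed by A^(i+1) but not by A^i. *)
  have : A ^+ (N - i) *m x \in mxker (A ^+ i.+1).
    by rewrite mem_mxker -mulmx_exprD addSn subnKC // xN1.
  by rewrite -eq_ker mem_mxker -mulmx_exprD subnKC // (negPf xN).
have := leq_trans (grow _ (leqnn _)) (dimvS (subvf _)).
by rewrite dim_cV ltnNge dN.
Qed.

Lemma mxker_exprD N j : (d <= N)%N -> forall x : 'cV[R]_d,
  A ^+ (j + N) *m x = 0 -> A ^+ N *m x = 0.
Proof.
move=> dN x; elim: j => // j IH h; apply: IH; apply: mxker_exprS => //.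
exact: leq_trans dN (leq_addl _ _).
Qed.

Lemma mul_expr_skew (F : 'M[R]_d) N :
  F *m A = - A^T *m F -> F *m A ^+ N = ((- A) ^+ N)^T *m F.
Proof.
move=> FA; elim: N => [|N IH]; first by rewrite !expr0 trmx1 mulmx1 mul1mx.
rewrite exprSr [LHS]mulmxA IH -mulmxA FA exprS trmx_mul.
by rewrite linearN /= mulmxA.
Qed.

(** The hypothesis on [F] says that A is skew for the form F, so F(x, A^N y) equals F(A^N x, y) up
    to sign. *)
Lemma fitting_orthogonal (F : 'M[R]_d) N (x y : 'cV[R]_d) :
  F *m A = - A^T *m F -> A ^+ N *m x = 0 -> x^T *m F *m (A ^+ N *m y) = 0.
Proof.
move=> FA x0; rewrite mulmxA -(mulmxA _ F) mul_expr_skew // mulmxA -trmx_mul.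
suff -> : (- A) ^+ N *m x = 0 by rewrite trmx0 !mul0mx.
by rewrite exprNn -mulmxE -mulmxA x0 mulmx0.
Qed.

End Fitting.

(** * Parity of the index under an imaginary spectrum *)

Section Parity.
Variable R : realType.

Lemma vspace_basis_mx d (V : {vspace 'cV[R]_d}) :
  exists2 S : 'M[R]_(d, \dim V),
    (forall y : 'cV_(\dim V), S *m y = 0 -> y = 0) & mximg S = V.
Proof.
pose S : 'M[R]_(d, \dim V) := \matrix_(i, j) (vbasis V)`_j i 0.
have SE y : S *m y = \sum_j y j 0 *: (vbasis V)`_j.
  apply/colP => i; rewrite mxE summxE; apply: eq_bigr => j _.
  by rewrite !mxE mulrC.
exists S.
  move=> y; rewrite SE => y0; have /freeP/(_ _ y0) h := basis_free (vbasisP V).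
  by apply/colP => j; rewrite h mxE.
apply/vspaceP => x; apply/mximgP/idP => [[y ->]|xV].
  by rewrite SE; apply: memv_suml => j _; rewrite memvZ // vbasis_mem // mem_nth ?size_tuple.
exists (\col_j coord (vbasis V) j x); rewrite SE [LHS](coord_vbasis xV).
by apply: eq_bigr => j _; rewrite mxE.
Qed.

(** The Gram matrix of [B] in an arbitrary basis of [V] is diagonalised. The basis need not be
    orthonormal, so only the signs in [D] are intrinsic. *)
Lemma form_orthodiag d (B : 'M[R]_d) (V : {vspace 'cV[R]_d}) : B^T = B ->
  exists p (T : 'M[R]_(d, p)) (D : 'rV[R]_p),
    [/\ forall y : 'cV_p, T *m y = 0 -> y = 0, mximg T = V &
        T^T *m B *m T = diag_mx D].
Proof.
move=> Bsym; have [S Sinj SV] := vspace_basis_mx V.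
have [|P [D P1 PD]] := @symmetric_orthodiag _ _ (S^T *m B *m S).
  by rewrite !trmx_mul trmxK Bsym mulmxA.
have Pinv : P *m P^T = 1%:M by apply: mulmx1C.
exists (\dim V), (S *m P), D; split=> [y||]; last by rewrite trmx_mul -PD !mulmxA.
  by rewrite -mulmxA => /Sinj Py; rewrite -[y]mul1mx -P1 -mulmxA Py mulmx0.
rewrite -[RHS]SV; apply/vspaceP => x; apply/mximgP/mximgP => -[y ->].
  by exists (P *m y); rewrite mulmxA.
by exists (P^T *m y); rewrite mulmxA -(mulmxA S) Pinv mulmx1.
Qed.

Lemma trmx_Jmx m : (Jmx R m)^T = - Jmx R m.
Proof.
rewrite /Jmx tr_block_mx opp_block_mx !trmx0 linearN /= trmx1.
by rewrite !oppr0 opprK.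
Qed.

Lemma Jmx_sqr m : Jmx R m *m Jmx R m = - 1%:M.
Proof.
rewrite /Jmx mulmx_block !mulmx0 !mul0mx mulmx1 mul1mx !addr0 !add0r.
by rewrite [in RHS]scalar_mx_block opp_block_mx !oppr0.
Qed.

Theorem index_parity m (B : 'M[R]_(m + m)) N :
  (m + m <= N)%N -> B^T = B -> spectrally_stable B ->
  odd (nneg B) = odd (nneg_on B (mxker ((Jmx R m *m B) ^+ N))).
Proof.
move=> dN Bsym stable; set A := Jmx R m *m B; set K := A ^+ N.
have JA : Jmx R m *m A = - B by rewrite mulmxA Jmx_sqr mulNmx mul1mx.
have BA : B *m A = - A^T *m B.
  by rewrite /A trmx_mul trmx_Jmx Bsym mulmxN opprK mulmxA.
have JskewA : Jmx R m *m A = - A^T *m Jmx R m.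
  by rewrite JA /A trmx_mul trmx_Jmx mulmxN opprK Bsym -mulmxA Jmx_sqr mulmxN mulmx1.
have Aeig a : eigenvalue A a -> a = 0.
  by rewrite -(eigenvalue_map (real_complex R)) => /stable.
have [r0 [T0 [D0 [T0inj T0V T0D]]]] := form_orthodiag (mxker K) Bsym.
have [r1 [T1 [D1 [T1inj T1V T1D]]]] := form_orthodiag (mximg K) Bsym.
have KT0 (y : 'cV_r0) : K *m (T0 *m y) = 0.
  by apply/eqP; rewrite -mem_mxker -T0V; apply/mximgP; exists y.
have T1K (y : 'cV_r1) : exists z : 'cV_(m + m), T1 *m y = K *m z.
  by apply/mximgP; rewrite -T1V; apply/mximgP; exists y.
(* K is injective on its image: K (K z) = 0 forces K z = 0, the kernels of powers being stationary
   from [N] on. *)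
have K_disj (y : 'cV_r1) : K *m (T1 *m y) = 0 -> y = 0.
  have [z T1z] := T1K y; rewrite T1z -mulmx_exprD => /(mxker_exprD dN) z0.
  by apply: T1inj; rewrite T1z.
(* Applied below to both forms, [F = B] and [F = J]. *)
have orth F : F *m A = - A^T *m F -> T0^T *m F *m T1 = 0.
  move=> FA; apply/matrixP => i j; have [z T1z] := T1K (delta_mx j 0).
  have : row i (col j (T0^T *m F *m T1)) = 0.
    have := fitting_orthogonal z FA (KT0 (delta_mx i 0)).
    by rewrite -T1z trmx_mul trmx_delta rowE colE !mulmxA.
  by move=> /matrixP/(_ 0 0); rewrite [LHS]mxE [LHS]mxE => ->; rewrite !mxE.
pose T := row_mx T0 T1.
have Tinj (y : 'cV_(r0 + r1)) : T *m y = 0 -> y = 0.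
  rewrite -[y]vsubmxK mul_row_col => y0.
  have y1 : dsubmx y = 0.
    by apply: K_disj; rewrite -[LHS]add0r -(KT0 (usubmx y)) -mulmxDr y0 mulmx0.
  have -> : usubmx y = 0 by apply: T0inj; rewrite -y0 y1 mulmx0 addr0.
  by rewrite y1 col_mx0.
have TD : T^T *m B *m T = diag_mx (row_mx D0 D1).
  have BT : T1^T *m B *m T0 = 0.
    by apply: trmx_inj; rewrite !trmx_mul trmxK Bsym mulmxA orth // trmx0.
  by rewrite tr_row_mx mul_col_mx mul_col_row T0D T1D BT diag_mx_row orth.
have dimV : (r0 + r1)%N = (m + m)%N.
  rewrite -(dim_mximg T0inj) -(dim_mximg T1inj) T0V T1V.
  have := limg_ker_dim (linfun (mulmx K : 'cV[R]_(m + m) -> 'cV[R]_(m + m))) fullv.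
  by rewrite capfv dim_cV.
have Tfull : mximg T = fullv.
  by apply/eqP; rewrite eqEdim subvf (dim_mximg Tinj) dimV dim_cV /=.
(* [T] is onto: writing y = T z gives |y|^2 = z^T T^T y = 0. *)
have T_trinj (y : 'cV[R]_(m + m)) : T^T *m y = 0 -> y = 0.
  move=> Ty; have : y \in mximg T by rewrite Tfull memvf.
  case/mximgP => z yz.
  have : y^T *m y = 0 by rewrite [in y^T]yz trmx_mul -mulmxA Ty mulmx0.
  rewrite -{2}[y]trmxK => /matrixP/(_ 0 0) /eqP; rewrite [X in _ == X]mxE.
  by rewrite row_sqnorm_eq0 trmx_eq0 => /eqP.
(* [P] and [T] both parametrise the whole space, so their diagonal forms have equally many negative
   entries. *)
have nnegB : nneg B = (#|[pred i | (D0 0 i < 0)%R]| + #|[pred i | (D1 0 i < 0)%R]|)%N.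
  have [P [D P1 PD]] := symmetric_orthodiag Bsym.
  have Pinj (y : 'cV_(m + m)) : P *m y = 0 -> y = 0.
    by move=> Py; rewrite -[y]mul1mx -P1 -mulmxA Py mulmx0.
  rewrite (nneg_diag P1 PD) -(nneg_on_diag Pinj PD).
  have -> : mximg P = mximg T.
    by rewrite Tfull; apply/eqP; rewrite eqEdim subvf (dim_mximg Pinj) dim_cV /=.
  rewrite (nneg_on_diag Tinj TD) -!sum1_card !big_mkcond big_split_ord /=.
  by congr addn; rewrite [RHS]big_mkcond /=; apply: eq_bigr => i _;
    rewrite !inE ?row_mxEl ?row_mxEr.
rewrite nnegB -T0V (nneg_on_diag T0inj T0D) oddD.
suff /negPf-> : ~~ odd #|[pred i | D1 0 i < 0]| by rewrite addbF.
apply: even_neg_of_prod_gt0.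
suff : 0 < \det (diag_mx D1) by rewrite det_diag.
(* [A1] is the matrix of A on im K, which is invariant because A commutes with its power K. *)
have [A1 A1P] : exists A1, A *m T1 = T1 *m A1.
  have /choice[f fP] j : exists y, A *m col j T1 = T1 *m y.
    have [z Tz] := T1K (delta_mx j 0).
    apply/mximgP; rewrite T1V; apply/mximgP; exists (A *m z).
    have AK : A *m K = K *m A by apply: (commrX N (commr_refl A)).
    by rewrite colE Tz mulmxA AK mulmxA.
  exists (\matrix_(i, j) f j i 0); apply/matrixP => i j.
  transitivity ((A *m col j T1) i 0); last rewrite fP.
    by rewrite [LHS]mxE [RHS]mxE; apply: eq_bigr => k _; rewrite [col _ _ _ _]mxE.
  by rewrite [LHS]mxE [RHS]mxE; apply: eq_bigr => k _; rewrite mxE.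
pose G := T1^T *m Jmx R m *m T1.
have BG : diag_mx D1 = - G *m A1.
  rewrite -T1D /G mulNmx -!mulmxA -A1P (mulmxA (Jmx R m)) JA.
  by rewrite mulNmx mulmxN opprK.
have A1pos : 0 < \det A1.
  apply: det_gt0_of_no_eigenvalue => a; apply/eigenvalue_colP => -[y ya yn0].
  have T1y : A *m (T1 *m y) = a *: (T1 *m y).
    by rewrite mulmxA A1P -mulmxA ya scalemxAr.
  have T1yn0 : T1 *m y != 0 by apply: contraNneq yn0 => /T1inj->.
  have a0 : a = 0 by apply: Aeig; apply/eigenvalue_colP; exists (T1 *m y).
  (* An eigenvector for 0 in im K would also lie in ker K. *)
  move/eqP: yn0; apply; apply: K_disj; apply: (@mxker_exprD _ _ _ _ 1) => //.
  by rewrite add1n exprSr -mulmxA T1y a0 scale0r mulmx0.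
rewrite BG det_mulmx pmulr_lgt0 //; apply: skew_det_gt0.
  by rewrite linearN /= /G !trmx_mul trmxK trmx_Jmx mulNmx mulmxN mulmxA.
apply/det0P => -[v vn0 vG]; move/eqP: vn0; apply; apply: trmx_inj; rewrite trmx0.
have Gv : G *m v^T = 0.
  apply: trmx_inj; rewrite trmx0 trmx_mul trmxK -vG; congr mulmx.
  by rewrite /G !trmx_mul trmxK trmx_Jmx mulNmx mulmxN mulmxA.
(* For [v] in the kernel of the Gram matrix of J, the vector J T1 v^T is orthogonal to the columns
   of [T1], and to those of [T0] by [orth]; hence it vanishes. *)
apply: T1inj; have /T_trinj JT : T^T *m (Jmx R m *m (T1 *m v^T)) = 0.
  by rewrite tr_row_mx mul_col_mx !mulmxA orth // mul0mx Gv col_mx0.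
have : Jmx R m *m (Jmx R m *m (T1 *m v^T)) = 0 by rewrite JT mulmx0.
by rewrite mulmxA Jmx_sqr mulNmx mul1mx => /eqP; rewrite oppr_eq0 => /eqP.
Qed.

End Parity.

(** * The Hessian of the potential *)

Section Hessian.
Variable R : realType.

(** Turns directional derivatives into derivatives of functions of one real variable. *)
Lemma derive_line (V W : normedModType R) (f : V -> W) x v :
  'D_v f x = 'D_1 (fun t : R => f (t *: v + x)) 0.
Proof.
rewrite /derive.
have -> // : (fun h : R => h^-1 *: ((f \o shift x) (h *: v) - f x)) =
    (fun h : R => h^-1 *: (((fun t : R => f (t *: v + x)) \o shift 0) (h *: 1)
                           - f (0 *: v + x))).
by apply/funext => h /=; rewrite scale0r add0r addr0 [h *: 1]mulr1.
Qed.

Lemma dotC d (x y : 'cV[R]_d) : dot x y = dot y x.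
Proof. by rewrite /dot -[in LHS](trmxK y) -trmx_mul mxE. Qed.

Lemma dotDl d (x y z : 'cV[R]_d) : dot (x + y) z = dot x z + dot y z.
Proof. by rewrite /dot linearD /= mulmxDl mxE. Qed.

Lemma dotZl d (a : R) (x z : 'cV[R]_d) : dot (a *: x) z = a * dot x z.
Proof. by rewrite /dot linearZ /= -scalemxAl mxE. Qed.

Lemma dot_eq0 d (x : 'cV[R]_d) : (dot x x == 0) = (x == 0).
Proof. by rewrite -[x in LHS]trmxK /dot trmxK row_sqnorm_eq0 trmx_eq0. Qed.

Lemma dot_ge0 d (x : 'cV[R]_d) : 0 <= dot x x.
Proof. by rewrite -[x]trmxK /dot trmxK row_sqnorm_ge0. Qed.

Lemma enorm_gt0 d (x : 'cV[R]_d) : x != 0 -> 0 < enorm x.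
Proof. by move=> x0; rewrite sqrtr_gt0 lt_def dot_eq0 x0 dot_ge0. Qed.

Lemma is_derive_dot_line d (a b z : 'cV[R]_d) :
  is_derive (0 : R) 1 (fun t => dot (t *: b + a) z) (dot b z).
Proof.
have -> : (fun t => dot (t *: b + a) z) = (fun t : R => t * dot b z + dot a z).
  by apply/funext => t; rewrite dotDl dotZl.
by apply: is_derive_eq; rewrite scaler0 add0r addr0 [LHS]mulr1.
Qed.

Lemma is_derive_enorm_line d (a b : 'cV[R]_d) : a != 0 ->
  is_derive (0 : R) 1 (fun t => enorm (t *: b + a)) (dot a b / enorm a).
Proof.
move=> a0.
have sq : is_derive (0 : R) 1 (fun t => dot (t *: b + a) (t *: b + a)) (2 * dot a b).
  have -> : (fun t => dot (t *: b + a) (t *: b + a)) =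
    (fun t : R => t * (t * dot b b + 2 * dot a b) + dot a a).
    apply/funext => t; rewrite dotDl dotZl !(dotC _ (t *: b + a)) !dotDl !dotZl (dotC b a).
    by ring.
  by apply: is_derive_eq; rewrite !scale0r mul0r !add0r addr0 [LHS]mulr1.
have sqr : is_derive (dot (0 *: b + a) (0 *: b + a)) 1 (@Num.sqrt R) (2 * enorm a)^-1.
  by rewrite scale0r add0r; apply: is_derive1_sqrt; rewrite lt_def dot_eq0 a0 dot_ge0.
apply: (is_derive_eq (is_derive1_comp sqr sq)).
have := enorm_gt0 a0; set r := enorm a => r0; field; exact: lt0r_neq0.
Qed.

Lemma is_derive_inv_enorm_line d (c : R) (a b : 'cV[R]_d) : a != 0 ->
  is_derive (0 : R) 1 (fun t => c / enorm (t *: b + a))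
    (- c * dot a b / enorm a ^+ 3).
Proof.
move=> a0; have r0 := enorm_gt0 a0.
have der := is_derive_enorm_line b a0.
have n0 : enorm (0 *: b + a) != 0 by rewrite scale0r add0r lt0r_neq0.
have inv := is_deriveV (f := fun t : R => enorm (t *: b + a)) n0 der.
apply: (is_derive_eq (is_deriveZ c inv)).
rewrite scale0r add0r /GRing.scale /=; set r := enorm a in r0 *.
by field; exact: lt0r_neq0.
Qed.

Lemma is_derive_inv_enorm3_line d (c : R) (a b z : 'cV[R]_d) : a != 0 ->
  is_derive (0 : R) 1 (fun t => - c * dot (t *: b + a) z / enorm (t *: b + a) ^+ 3)
    (- c * (dot b z / enorm a ^+ 3 - 3 * dot a z * dot a b / enorm a ^+ 5)).
Proof.
move=> a0; have r0 := enorm_gt0 a0.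
have der : is_derive (0 : R) 1 (fun t => enorm (t *: b + a) ^+ 3)
    (3 * enorm a ^+ 2 * (dot a b / enorm a)).
  apply: (is_derive_eq (is_deriveX 3 (is_derive_enorm_line b a0))).
  by rewrite scale0r add0r.
have n0 : enorm (0 *: b + a) ^+ 3 != 0 by rewrite scale0r add0r expf_neq0 // lt0r_neq0.
have inv := is_deriveV (f := fun t : R => enorm (t *: b + a) ^+ 3) n0 der.
apply: (is_derive_eq (is_deriveM (is_deriveZ (- c) (is_derive_dot_line a b z)) inv)).
rewrite /= scale0r add0r /GRing.scale /=; set r := enorm a in r0 *.
by field; exact: lt0r_neq0.
Qed.

Lemma is_derive_fsum n (P : pred 'I_n) (h : 'I_n -> R -> R) (dh : 'I_n -> R) (x : R) :
  (forall i, P i -> is_derive x 1 (h i) (dh i)) ->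
  is_derive x 1 (fun t => \sum_(i | P i) h i t) (\sum_(i | P i) dh i).
Proof.
move=> hP; rewrite [X in is_derive _ _ _ X]big_mkcond.
have -> : (fun t => \sum_(i | P i) h i t) =
    \sum_i (fun t => if P i then h i t else 0).
  by apply/funext => t; rewrite fct_sumE big_mkcond.
apply: is_derive_sum => i; case: ifP => [/hP//|_].
exact: is_derive_cst.
Qed.

Variables (n : nat) (mass : 'I_n -> R).

Definition gap (x : 'cV[R]_(cdim n)) i j := body x i - body x j.

Definition collision_free (x : 'cV[R]_(cdim n)) :=
  forall i j, i != j -> gap x i j != 0.

Lemma gap_line t v x i j : gap (t *: v + x) i j = t *: gap v i j + gap x i j.
Proof. by apply/matrixP => a b; rewrite !mxE; ring. Qed.

Lemma ltn_ord_neq (i j : 'I_n) : (i < j)%N -> i != j.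
Proof. by move=> ij; rewrite -val_eqE neq_ltn ij. Qed.

Lemma derive_U x v : collision_free x ->
  'D_v (U mass) x = \sum_(i < n) \sum_(j < n | (i < j)%N)
    - (mass i * mass j) * dot (gap x i j) (gap v i j) / enorm (gap x i j) ^+ 3.
Proof.
move=> xfree; rewrite derive_line; apply: derive_val.
have -> : (fun t : R => U mass (t *: v + x)) = (fun t => \sum_(i < n)
    \sum_(j < n | (i < j)%N) mass i * mass j / enorm (t *: gap v i j + gap x i j)).
  apply/funext => t; apply: eq_bigr => i _; apply: eq_bigr => j _.
  by rewrite -gap_line.
apply: is_derive_fsum => i _; apply: is_derive_fsum => j ij.
by apply: is_derive_inv_enorm_line; apply: xfree; exact: ltn_ord_neq.
Qed.

(** A second derivative requires the formula for the first one on a whole neighbourhood. *)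
Lemma near_collision_free x v : collision_free x ->
  (\forall t \near (0 : R), collision_free (t *: v + x))%classic.
Proof.
move=> xfree; near=> t => i j; move: j; move: i; near: t.
apply: filter_forall => i /=; apply: filter_forall => j /=.
have [->|ij] := eqVneq i j; first exact: filterE.
set a := gap x i j; set b := gap v i j.
have [der _] := is_derive_dot_line a b a.
have cont : {for (0 : R), continuous (fun t : R => dot (t *: b + a) a)}.
  by apply: differentiable_continuous; exact/derivable1_diffP.
(* The inner product of [t *: b + a] with [a] is continuous in [t] and positive at 0; where it is
   positive, [t *: b + a] is nonzero. *)
have pos : 0 < dot (0 *: b + a) a.
  by rewrite scale0r add0r lt_def dot_eq0 xfree ?dot_ge0.
near=> t; move=> _; rewrite gap_line -/a -/b.
have : 0 < dot (t *: b + a) a by near: t; exact: (cvgr_gt _ cont).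
by apply: contraTneq => ->; rewrite /dot trmx0 mul0mx mxE ltxx.
Unshelve. all: by end_near.
Qed.

(** The right-hand side is symmetric in [v] and [w]; the symmetry of the Hessian is read off from
    it. *)
Lemma derive2_U x v w : collision_free x ->
  'D_w (fun y => 'D_v (U mass) y) x = \sum_(i < n) \sum_(j < n | (i < j)%N)
    - (mass i * mass j) * (dot (gap w i j) (gap v i j) / enorm (gap x i j) ^+ 3
      - 3 * dot (gap x i j) (gap v i j) * dot (gap x i j) (gap w i j)
        / enorm (gap x i j) ^+ 5).
Proof.
move=> xfree; rewrite derive_line; apply: derive_val.
pose g t := \sum_(i < n) \sum_(j < n | (i < j)%N) - (mass i * mass j) *
  dot (t *: gap w i j + gap x i j) (gap v i j) / enorm (t *: gap w i j + gap x i j) ^+ 3.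
apply: (@near_eq_is_derive _ _ _ g).
  near=> t; rewrite derive_U; last by near: t; exact: near_collision_free.
  by apply: eq_bigr => i _; apply: eq_bigr => j _; rewrite gap_line.
apply: is_derive_fsum => i _; apply: is_derive_fsum => j ij.
by apply: is_derive_inv_enorm3_line; apply: xfree; exact: ltn_ord_neq.
Unshelve. all: by end_near.
Qed.

Lemma hessU_sym x : collision_free x -> (hessU mass x)^T = hessU mass x.
Proof.
move=> xfree; apply/matrixP => a b; rewrite mxE [LHS]mxE [RHS]mxE.
etransitivity; first exact: (derive2_U (ei R a) (ei R b) xfree).
apply: esym; etransitivity; first exact: (derive2_U (ei R b) (ei R a) xfree).
apply: eq_bigr => i _; apply: eq_bigr => j _.
congr (_ * (_ / _ - _ / _)); first exact: dotC.
by rewrite mulrAC.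
Qed.

End Hessian.

(** * Dimension of E3 *)

Section Dimensions.
Variable R : realType.

(** By definition of [omega0], the symplectic complement of [V] is Euclidean-orthogonal to J V,
    which has the dimension of [V]. *)
Lemma dim_symp_orth d (V : {vspace 'cV[R]_(d + d)}) :
  (\dim (symp_orth V) + \dim V <= d + d)%N.
Proof.
pose f := linfun (mulmx (Jmx R d) : 'cV[R]_(d + d) -> 'cV[R]_(d + d)).
have Jinj (x : 'cV[R]_(d + d)) : Jmx R d *m x = 0 -> x = 0.
  move=> /(congr1 (mulmx (Jmx R d))); rewrite mulmxA Jmx_sqr mulmx0 mulNmx mul1mx.
  by move=> /eqP; rewrite oppr_eq0 => /eqP.
have <- : \dim (f @: V) = \dim V.
  rewrite limg_dim_eq //; apply/eqP; rewrite -subv0; apply/subvP => x.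
  by rewrite memv_cap memv_ker lfunE /= => /andP[_ /eqP/Jinj->]; rewrite mem0v.
rewrite -dimv_disjoint_sum.
  by apply: leq_trans (dimvS (subvf _)) _; rewrite dim_cV.
apply/eqP; rewrite -subv0; apply/subvP => y; rewrite memv_cap memv0.
case/andP=> /mem_symp_orth yV /memv_imgP[x /yV]; rewrite lfunE /= => xy yJ.
by rewrite -dot_eq0 {1}yJ -[dot _ _]/(omega0 x y) xy.
Qed.

Lemma dim_symplectic_basis d m (V : {vspace 'cV[R]_(d + d)}) (S : 'M[R]_(d + d, m + m)) :
  symplectic_basis V S -> \dim V = (m + m)%N.
Proof.
case=> bS _; rewrite -(span_basis bS); have := basis_free bS.
by rewrite /free => /eqP->; rewrite size_map -cardE card_ord.
Qed.

Variables (n : nat) (mass : 'I_n -> R).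
Hypothesis mass_gt0 : forall i, 0 < mass i.

Lemma body_mxcol (C : 'I_n -> 'cV[R]_4) i : body (\mxcol_(i < n) C i) i = C i.
Proof. exact: mxcolK. Qed.

Lemma body_blockwise (A : 'M[R]_4) (q : 'cV[R]_(cdim n)) i :
  body (blockwise n A *m q) i = A *m body q i.
Proof. by rewrite -{1}(submxcolK q) mul_mxdiag_mxcol body_mxcol. Qed.

Lemma body_Mmx (q : 'cV[R]_(cdim n)) i : body (Mmx mass *m q) i = mass i *: body q i.
Proof. by rewrite -{1}(submxcolK q) mul_mxdiag_mxcol body_mxcol mul_scalar_mx. Qed.

Lemma body_inj (x y : 'cV[R]_(cdim n)) : (forall i, body x i = body y i) -> x = y.
Proof. by move=> xy; rewrite -(submxcolK x) -(submxcolK y); apply: eq_mxcol. Qed.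

Lemma body0 i : body (0 : 'cV[R]_(cdim n)) i = 0.
Proof. exact: submxcol0. Qed.

Lemma bodyD (x y : 'cV[R]_(cdim n)) i : body (x + y) i = body x i + body y i.
Proof. exact: submxcolD. Qed.

Lemma Mmx_inj (x : 'cV[R]_(cdim n)) : Mmx mass *m x = 0 -> x = 0.
Proof.
move=> Mx; apply: body_inj => i; rewrite body0; apply/eqP.
have /eqP := body_Mmx x i.
by rewrite Mx body0 eq_sym scaler_eq0 gt_eqF //= mass_gt0.
Qed.

Definition lincomb k (F : 'I_k -> 'M[R]_4) (c : 'cV[R]_k) : 'M[R]_4 :=
  \sum_l c l 0 *: F l.

Lemma lincomb_span k (F : 'I_k -> 'M[R]_4) (As : seq 'M[R]_4) q c :
  (forall l, F l \in As) ->
  (col_mx (blockwise n (lincomb F c) *m q) 0 \in E2_spanned_by mass q As) &&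
  (col_mx 0 (Mmx mass *m (blockwise n (lincomb F c) *m q)) \in E2_spanned_by mass q As).
Proof.
move=> FAs.
have -> : blockwise n (lincomb F c) *m q = \sum_l c l 0 *: (blockwise n (F l) *m q).
  apply: body_inj => i; rewrite body_blockwise [RHS]submxcol_sum mulmx_suml.
  apply: eq_bigr => l _; rewrite -scalemxAl -body_blockwise.
  by apply/matrixP => a b; rewrite !mxE.
have memU l : col_mx (blockwise n (F l) *m q) 0 \in E2_spanned_by mass q As.
  by apply: memv_span; rewrite mem_cat (map_f (fun A => col_mx (blockwise n A *m q) 0)).
have memD l : col_mx 0 (Mmx mass *m (blockwise n (F l) *m q)) \in E2_spanned_by mass q As.
  apply: memv_span; rewrite mem_cat orbC.
  by rewrite (map_f (fun A => col_mx 0 (Mmx mass *m (blockwise n A *m q)))).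
apply/andP; split.
  have -> : col_mx (\sum_l c l 0 *: (blockwise n (F l) *m q)) 0 =
      \sum_l c l 0 *: col_mx (blockwise n (F l) *m q) (0 : 'cV_(cdim n)).
    elim/big_ind2 : _ => [|x X y Y <- <-|l _]; first by rewrite col_mx0.
      by rewrite add_col_mx addr0.
    by rewrite scale_col_mx scaler0.
  by apply: memv_suml => l _; rewrite memvZ.
have -> : col_mx 0 (Mmx mass *m (\sum_l c l 0 *: (blockwise n (F l) *m q))) =
    \sum_l c l 0 *: col_mx (0 : 'cV_(cdim n)) (Mmx mass *m (blockwise n (F l) *m q)).
  rewrite mulmx_sumr.
  elim/big_ind2 : _ => [|x X y Y <- <-|l _]; first by rewrite col_mx0.
    by rewrite add_col_mx addr0.
  by rewrite scale_col_mx scaler0 -scalemxAr.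
by apply: memv_suml => l _; rewrite memvZ.
Qed.

(* [E1 + E2] contains the direct sum of two copies of the space of
   configurations [v + X q], [v] a constant and [X] a combination of the [F l];
   the centre of mass condition makes [v] and [X] independent. *)
Lemma dim_E1_E2 k (F : 'I_k -> 'M[R]_4) (As : seq 'M[R]_4) q :
  (0 < n)%N -> (forall l, F l \in As) -> \sum_i mass i *: body q i = 0 ->
  (forall c, (forall i, lincomb F c *m body q i = 0) -> c = 0) ->
  ((4 + k).*2 <= \dim (E1 mass + E2_spanned_by mass q As))%N.
Proof.
move=> n_gt0 FAs centered Ffree.
pose Z : 'M[R]_(cdim n, 4 + k) := row_mx (\mxcol_(i < n) 1%:M)
  (\matrix_(a, l) (blockwise n (F l) *m q) a 0).
have ZE (y : 'cV_(4 + k)) :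
    Z *m y = \mxcol_(i < n) usubmx y + blockwise n (lincomb F (dsubmx y)) *m q.
  rewrite -{1}[y]vsubmxK mul_row_col mxcol_mul; congr (_ + _).
    by apply: eq_mxcol => i; rewrite mul1mx.
  apply: body_inj => i; rewrite body_blockwise mulmx_suml.
  apply/matrixP => a b; rewrite mxE mxE summxE; apply: eq_bigr => l _.
  by rewrite -scalemxAl -body_blockwise !(mxE, ord1) mulrC.
have Zinj (y : 'cV_(4 + k)) : Z *m y = 0 -> y = 0.
  rewrite ZE => Zy.
  have Zyi i : usubmx y + lincomb F (dsubmx y) *m body q i = 0.
    by rewrite -body_blockwise -(body_mxcol (fun=> usubmx y) i) -bodyD Zy body0.
  have y0 : usubmx y = 0.
    have : \sum_i mass i *: (usubmx y + lincomb F (dsubmx y) *m body q i) = 0.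
      by rewrite big1 // => i _; rewrite Zyi scaler0.
    under eq_bigr do rewrite scalerDr scalemxAr.
    rewrite big_split /= -mulmx_sumr centered mulmx0 addr0 -scaler_suml.
    move=> /eqP; rewrite scaler_eq0 => /orP[|/eqP//].
    rewrite gt_eqF //= (bigD1 (Ordinal n_gt0)) //= ltr_wpDr // sumr_ge0 // => i _.
    exact: ltW.
  have y1 : dsubmx y = 0.
    by apply: Ffree => i; have := Zyi i; rewrite y0 add0r.
  by rewrite -(vsubmxK y) y0 y1 col_mx0.
(* The momentum copy is multiplied by the mass matrix, which turns a constant [w] into the blocks
   [mass i *: w] of [E1]. *)
pose ZZ : 'M[R]_(cdim n + cdim n, _) := block_mx Z 0 0 (Mmx mass *m Z).
have ZZE (y : 'cV_((4 + k) + (4 + k))) :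
    ZZ *m y = col_mx (Z *m usubmx y) (Mmx mass *m (Z *m dsubmx y)).
  by rewrite -{1}[y]vsubmxK mul_block_col !mul0mx addr0 add0r mulmxA.
have ZZinj (y : 'cV_((4 + k) + (4 + k))) : ZZ *m y = 0 -> y = 0.
  rewrite ZZE => /eqP; rewrite col_mx_eq0 => /andP[/eqP/Zinj yu /eqP/Mmx_inj/Zinj yd].
  by rewrite -(vsubmxK y) yu yd col_mx0.
rewrite -addnn -(dim_mximg ZZinj); apply: dimvS; apply/subvP => x /mximgP[y ->].
have memZ (u w : 'cV_(4 + k)) : col_mx (Z *m u) (Mmx mass *m (Z *m w)) =
    col_mx (\mxcol_(i < n) usubmx u) (\mxcol_(i < n) (mass i *: usubmx w))
    + (col_mx (blockwise n (lincomb F (dsubmx u)) *m q) 0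
       + col_mx 0 (Mmx mass *m (blockwise n (lincomb F (dsubmx w)) *m q))).
  rewrite !ZE !add_col_mx addr0 add0r mulmxDr; congr (col_mx _ (_ + _)).
  by apply: body_inj => i; rewrite body_Mmx !body_mxcol.
rewrite ZZE memZ; apply: memv_add.
  by apply/mem_E1; exists (usubmx (usubmx y)), (usubmx (dsubmx y)).
have /andP[mu _] := lincomb_span q (dsubmx (usubmx y)) FAs.
have /andP[_ md] := lincomb_span q (dsubmx (dsubmx y)) FAs.
exact: memvD.
Qed.

End Dimensions.

(** * Independence of the matrices defining E2 *)

Section FreeFamilies.
Variable R : realType.

Definition nth_mx k (As : seq 'M[R]_4) (l : 'I_k) : 'M[R]_4 := nth 0 As l.

(** The indices have the shape that [big_ord_recl] produces, so that expanded sums fold back to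
    them. *)
Let o0 : 'I_4 := ord0.
Let o1 : 'I_4 := lift ord0 ord0.
Let o2 : 'I_4 := lift ord0 (lift ord0 ord0).
Let o3 : 'I_4 := lift ord0 (lift ord0 (lift ord0 ord0)).

Lemma dotE4 (u : 'cV[R]_4) :
  dot u u = u o0 0 ^+ 2 + u o1 0 ^+ 2 + u o2 0 ^+ 2 + u o3 0 ^+ 2.
Proof. by rewrite /dot mxE !big_ord_recl big_ord0 !mxE; ring. Qed.

(** Euler's four-square identity: the product has squared norm |c|^2 |u|^2. *)
Lemma quaternion_free (u c : 'cV[R]_4) : u != 0 ->
  lincomb (nth_mx [:: 1%:M; quat_i R; quat_j R; quat_k R]) c *m u = 0 -> c = 0.
Proof.
rewrite -(dot_eq0 u) dotE4 => u0 /matrixP cu.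
have := cu o0 0; have := cu o1 0; have := cu o2 0; have := cu o3 0; clear cu.
rewrite /lincomb !big_ord_recl big_ord0 /nth_mx /= !mxE !big_ord_recl !big_ord0 !mxE.
rewrite -!val_eqE /= -/o0 -/o1 -/o2 -/o3.
move=> e3 e2 e1 e0; apply/eqP; rewrite -dot_eq0 dotE4.
move: (c o0 0) (c o1 0) (c o2 0) (c o3 0) (u o0 0) (u o1 0) (u o2 0) (u o3 0) u0 e0 e1 e2 e3.
move=> c0 c1 c2 c3 x y z t u0 e0 e1 e2 e3.
have h0 : c0 * x - c1 * y + c2 * z - c3 * t = 0 by rewrite -e0; ring.
have h1 : c1 * x + c0 * y + c3 * z + c2 * t = 0 by rewrite -e1; ring.
have h2 : - c2 * x - c3 * y + c0 * z + c1 * t = 0 by rewrite -e2; ring.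
have h3 : c3 * x - c2 * y - c1 * z + c0 * t = 0 by rewrite -e3; ring.
rewrite -(mulIr_eq0 _ (mulIf u0)); apply/eqP.
transitivity ((c0 * x - c1 * y + c2 * z - c3 * t) ^+ 2
  + (c1 * x + c0 * y + c3 * z + c2 * t) ^+ 2
  + (- c2 * x - c3 * y + c0 * z + c1 * t) ^+ 2
  + (c3 * x - c2 * y - c1 * z + c0 * t) ^+ 2); first by ring.
by rewrite h0 h1 h2 h3; ring.
Qed.

Definition planar_family :=
  [:: 1%:M; Klr R 1 2; Klr R 1 3; Klr R 1 4; Klr R 2 3; Klr R 2 4].

Lemma in_R2x0_entries (u : 'cV[R]_4) : in_R2x0 u -> u o2 0 = 0 /\ u o3 0 = 0.
Proof. by move=> u2; rewrite !u2. Qed.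

(** On u = (x, y, 0, 0), the identity and [Klr 1 2] span the plane of motion; the two normal
    directions come from [Klr 1 3] and [Klr 1 4] if x is nonzero, from [Klr 2 3] and [Klr 2 4]
    otherwise. One nonzero body suffices, so collinear configurations are covered. *)
Lemma planar_free4 (u : 'cV[R]_4) : in_R2x0 u -> u != 0 ->
  exists2 F : 'I_4 -> 'M[R]_4, forall l, F l \in planar_family
    & forall c, lincomb F c *m u = 0 -> c = 0.
Proof.
move=> /in_R2x0_entries[u2 u3] u0.
have xy : u o0 0 ^+ 2 + u o1 0 ^+ 2 != 0.
  by move: u0; rewrite -dot_eq0 dotE4 u2 u3 expr0n /= !addr0.
have [x0|x0] := eqVneq (u o0 0) 0.
  have y0 : u o1 0 != 0 by move: xy; rewrite x0 expr0n /= add0r sqrf_eq0.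
  exists (nth_mx [:: 1%:M; Klr R 1 2; Klr R 2 3; Klr R 2 4]).
    by case=> -[|[|[|[|l]]]] hl //; rewrite /nth_mx /= !inE eqxx ?orbT.
  move=> c /matrixP cu.
  have := cu o0 0; have := cu o1 0; have := cu o2 0; have := cu o3 0; clear cu.
  rewrite /lincomb !big_ord_recl big_ord0 /nth_mx /= !mxE !big_ord_recl !big_ord0 !mxE.
  rewrite -!val_eqE /= -/o0 -/o1 -/o2 -/o3 u2 u3 x0.
  move=> e3 e2 e1 e0; apply/eqP; rewrite -dot_eq0 dotE4.
  have z a : a * u o1 0 = 0 -> a = 0.
    by move/eqP; rewrite mulf_eq0 (negPf y0) orbF => /eqP.
  have -> : c o0 0 = 0 by apply: z; rewrite -e1; ring.
  have -> : c o1 0 = 0 by apply: z; rewrite -[RHS]oppr0 -e0; ring.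
  have -> : c o2 0 = 0 by apply: z; rewrite -e2; ring.
  have -> : c o3 0 = 0 by apply: z; rewrite -e3; ring.
  by rewrite expr0n /= !addr0.
exists (nth_mx [:: 1%:M; Klr R 1 2; Klr R 1 3; Klr R 1 4]).
  by case=> -[|[|[|[|l]]]] hl //; rewrite /nth_mx /= !inE eqxx ?orbT.
move=> c /matrixP cu.
have := cu o0 0; have := cu o1 0; have := cu o2 0; have := cu o3 0; clear cu.
rewrite /lincomb !big_ord_recl big_ord0 /nth_mx /= !mxE !big_ord_recl !big_ord0 !mxE.
rewrite -!val_eqE /= -/o0 -/o1 -/o2 -/o3 u2 u3.
move: (u o0 0) (u o1 0) xy x0 => x y xy x0 e3 e2 e1 e0.
apply/eqP; rewrite -dot_eq0 dotE4.
move: (c o0 0) (c o1 0) (c o2 0) (c o3 0) e0 e1 e2 e3 => c0 c1 c2 c3 e0 e1 e2 e3.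
have h0 : c0 * x - c1 * y = 0 by rewrite -e0; ring.
have h1 : c1 * x + c0 * y = 0 by rewrite -e1; ring.
have z a b : b != 0 -> a * b = 0 -> a = 0 :> R.
  by move=> b0 /eqP; rewrite mulf_eq0 (negPf b0) orbF => /eqP.
have -> : c0 = 0.
  apply: (z _ _ xy).
  transitivity ((c0 * x - c1 * y) * x + (c1 * x + c0 * y) * y); first by ring.
  by rewrite h0 h1; ring.
have -> : c1 = 0.
  apply: (z _ _ xy).
  transitivity ((c1 * x + c0 * y) * x - (c0 * x - c1 * y) * y); first by ring.
  by rewrite h0 h1; ring.
have -> : c2 = 0 by apply: (z _ _ x0); rewrite -e2; ring.
have -> : c3 = 0 by apply: (z _ _ x0); rewrite -e3; ring.
by rewrite expr0n /= !addr0.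
Qed.

(** The six coefficients split into three pairs (a, b) with a x_i + b y_i = 0 for every body (x_i,
    y_i, 0, 0); a nonzero pair would make the bodies collinear. *)
Lemma planar_free6 n (u : 'I_n -> 'cV[R]_4) : (forall i, in_R2x0 (u i)) ->
    ~ (exists2 W : {vspace 'cV[R]_4}, \dim W = 1%N & forall i, u i \in W) ->
  forall c, (forall i, lincomb (nth_mx (k := 6) planar_family) c *m u i = 0) -> c = 0.
Proof.
move=> planar noncol c cu.
have line a b : (forall i, a * u i o0 0 + b * u i o1 0 = 0) -> a = 0 /\ b = 0.
  move=> ab; have [ab0|ab0] := eqVneq (a ^+ 2 + b ^+ 2) 0.
    by move/eqP: ab0; rewrite paddr_eq0 ?sqr_ge0 // !sqrf_eq0 => /andP[/eqP-> /eqP->].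
  exfalso; apply: noncol; pose w : 'cV[R]_4 := \col_k [:: - b; a; 0; 0]`_k.
  exists <[w]>%VS.
    rewrite dim_vline; suff -> : w != 0 by [].
    by rewrite -dot_eq0 dotE4 !mxE /= sqrrN expr0n /= !addr0 addrC.
  (* The coefficient of the orthogonal projection onto the line spanned by (-b, a, 0, 0). *)
  move=> i; apply/vlineP; exists ((a * u i o1 0 - b * u i o0 0) / (a ^+ 2 + b ^+ 2)).
  apply/eqP; rewrite -subr_eq0 -dot_eq0 dotE4 !mxE /=.
  have [-> ->] := in_R2x0_entries (planar i).
  move: (u i o0 0) (u i o1 0) (ab i) => x y abi.
  have hx : x - (a * y - b * x) / (a ^+ 2 + b ^+ 2) * - b = 0.
    transitivity (a / (a ^+ 2 + b ^+ 2) * (a * x + b * y)); first by field.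
    by rewrite abi mulr0.
  have hy : y - (a * y - b * x) / (a ^+ 2 + b ^+ 2) * a = 0.
    transitivity (b / (a ^+ 2 + b ^+ 2) * (a * x + b * y)); first by field.
    by rewrite abi mulr0.
  by rewrite hx hy !mulr0 subr0 expr0n /= !addr0.
have eqs i : [/\ c ord0 0 * u i o0 0 - c (lift ord0 ord0) 0 * u i o1 0 = 0,
    c (lift ord0 (lift ord0 ord0)) 0 * u i o0 0
      + c (lift ord0 (lift ord0 (lift ord0 (lift ord0 ord0)))) 0 * u i o1 0 = 0 &
    c (lift ord0 (lift ord0 (lift ord0 ord0))) 0 * u i o0 0
      + c (lift ord0 (lift ord0 (lift ord0 (lift ord0 (lift ord0 ord0))))) 0
        * u i o1 0 = 0].
  have /matrixP cui := cu i.
  have := cui o0 0; have := cui o2 0; have := cui o3 0; clear cui.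
  have [u2 u3] := in_R2x0_entries (planar i).
  rewrite /lincomb !big_ord_recl big_ord0 /nth_mx /= !mxE !big_ord_recl !big_ord0 !mxE.
  rewrite -!val_eqE /= -/o0 -/o1 -/o2 -/o3 u2 u3 => e3 e2 e0.
  by split; [rewrite -e0|rewrite -e2|rewrite -e3]; ring.
have [|c0 c1] := line (c ord0 0) (- c (lift ord0 ord0) 0).
  by move=> i; have [<- _ _] := eqs i; ring.
have [c2 c4] := line _ _ (fun i => let: And3 _ h _ := eqs i in h).
have [c3 c5] := line _ _ (fun i => let: And3 _ _ h := eqs i in h).
apply/eqP; rewrite -dot_eq0 /dot mxE !big_ord_recl big_ord0 !mxE.
move/eqP: c1; rewrite oppr_eq0 => /eqP c1.
by rewrite c0 c1 c2 c3 c4 c5 !mulr0 !addr0.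
Qed.

End FreeFamilies.

(** * Symmetry of B3 and the bound on dim E3 *)

Section RelativeEquilibria.
Variables (R : realType) (n : nat) (mass : 'I_n -> R).

Lemma cdimE : cdim n = (4 * n)%N.
Proof. by rewrite /cdim sum_nat_const card_ord mulnC. Qed.

Lemma tr_blockwise (A : 'M[R]_4) : (blockwise n A)^T = blockwise n A^T.
Proof. exact: tr_mxdiag. Qed.

Lemma blockwiseN (A : 'M[R]_4) : blockwise n (- A) = - blockwise n A.
Proof. exact: mxdiagN. Qed.

Lemma tr_J2 : (J2 R)^T = - J2 R.
Proof.
apply/matrixP => a b; rewrite !mxE.
by case: a b => [[|[|a]]] ha [[|[|b]]] hb //=; rewrite ?oppr0 ?opprK.
Qed.

Lemma tr_block_skew p (A D : 'M[R]_p) : A^T = - A -> D^T = - D ->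
  (block_mx A 0 0 D)^T = - block_mx A 0 0 D.
Proof. by move=> tA tD; rewrite tr_block_mx opp_block_mx !trmx0 !oppr0 tA tD. Qed.

Lemma tr_Kstar q : (Kstar mass q)^T = - Kstar mass q.
Proof.
have trZ a : (a *: J2 R)^T = - (a *: J2 R) by rewrite linearZ /= tr_J2 scalerN.
rewrite /Kstar; case: ifP => _; rewrite tr_blockwise -blockwiseN; congr blockwise.
  by apply: (tr_block_skew (trZ (kU mass q)) (D := 0)); rewrite trmx0 oppr0.
exact: (tr_block_skew (trZ (kU mass q)) (trZ (- kU mass q))).
Qed.

Lemma tr_Mmx : (Mmx mass)^T = Mmx mass.
Proof. by rewrite tr_mxdiag; apply: eq_mxdiag => i; rewrite tr_scalar_mx. Qed.

(** [B3] is the Gram matrix S^T (J L) S in the symplectic basis, and J L is symmetric because its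
    diagonal blocks are and [Kstar] is skew. *)
Lemma associated_B3_sym q m (B3 : 'M[R]_(m + m)) :
  central_configuration mass q -> associated_B3 mass q B3 -> B3^T = B3.
Proof.
move=> [apart _ _ _] [S [L3 [[_ SJS] LS ->]]].
have JL : (Jmx R (cdim n) *m Lstar mass q)^T = Jmx R (cdim n) *m Lstar mass q.
  rewrite /Jmx /Lstar mulmx_block !mul0mx !mul1mx !mulNmx !mul1mx !addr0 !add0r.
  rewrite tr_block_mx linearN /= linearN /= tr_Kstar trmx_inv tr_Mmx hessU_sym ?opprK //.
  by move=> i j ij; rewrite subr_eq0 apart.
have -> : Jmx R m *m L3 = S^T *m (Jmx R (cdim n) *m Lstar mass q) *m S.
  by rewrite -SJS -!mulmxA -LS.
by move: JL; set X := _ *m Lstar _ _ => JL; rewrite trmx_mul (trmx_mul S^T) trmxK JL mulmxA.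
Qed.

Lemma central_configuration_nonzero q :
  central_configuration mass q -> exists i, body q i != 0.
Proof.
move=> [_ _ q1 _]; apply/existsP; apply: contraT; rewrite negb_exists => /forallP q0.
have q_eq0 : q = 0.
  by apply: body_inj => i; rewrite body0; apply/eqP; rewrite -[_ == _]negbK.
by move/eqP: q1; rewrite q_eq0 /dot mulmx0 mxE eq_sym oner_eq0.
Qed.

Lemma half_dim_E3 q m (B3 : 'M[R]_(m + m)) k : associated_B3 mass q B3 ->
  (k <= \dim (E1 mass + E2 mass q))%N -> (m + m <= 8 * n - k)%N.
Proof.
move=> [S [L3 [/dim_symplectic_basis dE _ _]]].
(* Adding the two dimension bounds gives m + m + k <= 8n, so the truncated subtraction is exact. *)
have := dim_symp_orth (E1 mass + E2 mass q)%VS; rewrite -/(E3 mass q) dE.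
by move: (\dim (E1 mass + E2 mass q)%VS) cdimE => r; lia.
Qed.

Hypothesis mass_gt0 : forall i, 0 < mass i.
Hypothesis n_gt0 : (0 < n)%N.

Lemma mem_nth_mx k (As : seq 'M[R]_4) (l : 'I_k) : size As = k -> nth_mx As l \in As.
Proof. by move=> sz; apply: mem_nth; rewrite sz. Qed.

Lemma dim_E1_E2_ge16 q : central_configuration mass q ->
  (planar_RE mass q -> forall j, in_R2x0 (body q j)) ->
  (16 <= \dim (E1 mass + E2 mass q))%N.
Proof.
move=> cc planar; have [i qi] := central_configuration_nonzero cc.
have [_ centered _ _] := cc.
rewrite /E2; case: asboolP => [/planar pl|_].
  have [F FA Ffree] := planar_free4 (pl i) qi.
  by apply: (@dim_E1_E2 R n mass mass_gt0 4 F _ q) => // c cq; apply: Ffree.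
apply: (@dim_E1_E2 R n mass mass_gt0 4 (nth_mx [:: 1%:M; quat_i R; quat_j R; quat_k R])
  _ q n_gt0 _ centered) => [l|c cq].
  exact: mem_nth_mx.
exact: quaternion_free qi (cq i).
Qed.

Lemma dim_E1_E2_ge20 q : central_configuration mass q -> planar_RE mass q ->
  (forall j, in_R2x0 (body q j)) -> ~ collinear_configuration q ->
  (20 <= \dim (E1 mass + E2 mass q))%N.
Proof.
move=> [_ centered _ _] plRE pl noncol; rewrite /E2; case: asboolP => // _.
apply: (@dim_E1_E2 R n mass mass_gt0 6 (nth_mx (planar_family R))
  _ q n_gt0 _ centered) => [l|c cq].
  exact: mem_nth_mx.
exact: planar_free6 cq.
Qed.

End RelativeEquilibria.

(** * Instability from the parity condition *)

Lemma odd_neq_of_modz (a b : nat) : (a%:Z - b%:Z = 1 %[mod 2])%Z -> odd b <> odd a.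
Proof. lia. Qed.

Theorem theorem1p1 (R : realType) (n : nat) (mass : 'I_n -> R)
    (q : 'cV[R]_(cdim n)) (m : nat) (B3 : 'M[R]_(m + m)) :
  (3 <= n)%N ->
  (forall i, 0 < mass i) ->
  central_configuration mass q ->
  (planar_RE mass q -> forall j, in_R2x0 (body q j)) ->
  associated_B3 mass q B3 ->
  ((~ planar_RE mass q \/ planar_RE mass q /\ collinear_configuration q) /\
     ((nneg_on B3 (mxker ((Jmx R m *m B3) ^+ (8 * n - 16))))%:Z
        - (nneg B3)%:Z = 1 %[mod 2])%Z
   \/
   (planar_RE mass q /\ planar_configuration q /\
      ~ collinear_configuration q) /\
     ((nneg_on B3 (mxker ((Jmx R m *m B3) ^+ (8 * n - 20))))%:Z
        - (nneg B3)%:Z = 1 %[mod 2])%Z) ->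
  spectrally_unstable B3.
Proof.
move=> n3 mass_gt0 cc planar B3P parity stable.
have n_gt0 : (0 < n)%N by apply: leq_trans n3.
have B3sym := associated_B3_sym cc B3P.
case: parity => [[_ /odd_neq_of_modz]|[[plRE [_ noncol]] /odd_neq_of_modz]]; apply.
  apply: index_parity => //; apply: (half_dim_E3 B3P).
  exact: dim_E1_E2_ge16.
apply: index_parity => //; apply: (half_dim_E3 B3P).
exact: dim_E1_E2_ge20 (planar plRE) noncol.
Qed.
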